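(* For every positive integer $d$ and every positive integer $m$, let $$\mathcal{S}_d(m)=\begin{cases}[0,m]\subset\mathbb{R} & \text{if } d=1,\\ \mathrm{conv}\{\mathbf{0},\mathbf{e}_1,\ldots,\mathbf{e}_{d-1},(q_1(d),\ldots,q_{d-1}(d),d!\cdot m)\}\subset\mathbb{R}^d & \text{if } d\geq 2,\end{cases}$$ where $\mathbf{e}_i$ is the $i$-th unit coordinate vector of $\mathbb{R}^d$, $\mathbf{0}$ is the origin, and $q_i(d)=\dfrac{-d!}{i!+(i-1)!}$ for $1\leq i\leq d-1$. Then, for each fixed $d\geq 1$, the family $(\mathcal{S}_d(m))_{m\in\mathbb{Z}^+}$ is an Eulerian simplex family of dimension $d$; that is, there is a polynomial $T(x)$ of degree at most $d$, independent of $m$, with $T(1)=0$, such that $h^*_{\mathcal{S}_d(m)}(x)=m\,A_d(x)+T(x)$ for every positive integer $m$.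
   Context: For a $d$-dimensional integral polytope $\mathcal{P}\subset\mathbb{R}^d$ with Ehrhart polynomial $i(\mathcal{P},t)=\#(t\mathcal{P}\cap\mathbb{Z}^d)$, the $h^*$-polynomial $h^*_{\mathcal{P}}(x)$ is the polynomial of degree at most $d$ defined by $1+\sum_{t\geq1}i(\mathcal{P},t)x^t=h^*_{\mathcal{P}}(x)/(1-x)^{d+1}$. For a permutation $\pi=\pi_1\cdots\pi_d$ of $\{1,\ldots,d\}$, $\mathrm{des}(\pi)$ is the number of indices $j\in\{1,\ldots,d-1\}$ with $\pi_j>\pi_{j+1}$; the Eulerian polynomial is $A_d(x)=\sum_{\pi\in\mathfrak{S}_d}x^{1+\mathrm{des}(\pi)}$, where $\mathfrak{S}_d$ is the symmetric group. A parameterized family $(\mathcal{R}_d(m))_{m\in\mathbb{Z}^+}$ of $d$-dimensional integral simplices in $\mathbb{R}^d$ is called an Eulerian simplex family of dimension $d$ if $h^*_{\mathcal{R}_d(m)}(x)=mA_d(x)+T(x)$ for a polynomial $T(x)$ independent of $m$ with $T(1)=0$ and $\deg T\leq d$. *)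

(* Defs.v *)
From mathcomp Require Import all_boot all_order all_algebra all_fingroup finmap.
From mathcomp Require Import boolp classical_sets cardinality reals.

Set Implicit Arguments.
Unset Strict Implicit.
Unset Printing Implicit Defensive.

Import Order.TTheory GRing.Theory Num.Theory.
Local Open Scope classical_set_scope.
Local Open Scope ring_scope.

Definition convex_hull (R : realType) (V : lmodType R) (A : set V) : set V :=
  [set x | exists (n : nat) (a : 'I_n -> R) (p : 'I_n -> V),
     [/\ forall i, 0 <= a i, \sum_i a i = 1, forall i, A (p i)
       & x = \sum_i a i *: p i]].

Definition affinely_independent (R : realType) (V : lmodType R) (n : nat)
    (v : 'I_n -> V) : Prop :=
  forall a : 'I_n -> R, \sum_i a i = 0 -> \sum_i a i *: v i = 0 ->
    forall i, a i = 0.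

(* A full-dimensional simplex of R^d whose vertices are in Z^d. *)
Definition integral_simplex (R : realType) (d : nat) (P : set 'rV[R]_d) : Prop :=
  exists v : 'I_d.+1 -> 'rV[R]_d,
    [/\ forall i, v i \is a mxOver Num.int,
        affinely_independent v
      & P = convex_hull (range v)].

(* #(tP `&` Z^d); fset_set sends infinite sets to fset0, which does not arise
   for bounded P. *)
Definition ehrhart (R : realType) (d : nat) (P : set 'rV[R]_d) (t : nat) : nat :=
  #|` fset_set ([set t%:R *: x | x in P] `&`
                [set x : 'rV[R]_d | x \is a mxOver Num.int])|%fset.

(* Coefficients of the formal power series 1 + \sum_(t >= 1) i(P, t) x^t. *)
Definition ehrhart_series (R : realType) (d : nat) (P : set 'rV[R]_d)
    (t : nat) : int :=
  if t == 0%N then 1 else (ehrhart P t)%:Z.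

(* h is the h^*-polynomial of the d-dimensional polytope P in R^d: the defining
   identity is h = (1 - x)^(d+1) (1 + \sum_(t >= 1) i(P, t) x^t) in Z[[x]],
   which is read off coefficientwise (so that h is unique). *)
Definition is_hstar (R : realType) (d : nat) (P : set 'rV[R]_d)
    (h : {poly int}) : Prop :=
  (size h <= d.+1)%N /\
  forall n : nat,
    h`_n = \sum_(k < n.+1) ((1 - 'X) ^+ d.+1)`_k * ehrhart_series P (n - k).

Definition des (d : nat) (s : 'S_d) : nat :=
  #|[set j : 'I_d | [exists k : 'I_d, (k == j.+1 :> nat) && (s k < s j)%N]]%SET|.

Definition eulerian_poly (d : nat) : {poly int} :=
  \sum_(s : 'S_d) 'X^(1 + des s).

(* Only the values of fam at positive integers are relevant. *)
Definition eulerian_simplex_family (R : realType) (d : nat)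
    (fam : nat -> set 'rV[R]_d) : Prop :=
  (forall m : nat, (0 < m)%N -> integral_simplex (fam m)) /\
  exists T : {poly int},
    [/\ T.[1] = 0, (size T <= d.+1)%N
      & forall m : nat, (0 < m)%N ->
          is_hstar (fam m) (m%:R *: eulerian_poly d + T)].

Definition q (R : realType) (d i : nat) : R :=
  - (d`!)%:R / (i`! + (i.-1)`!)%:R.

(* The coordinate of index j : 'I_d is the (j + 1)-st one. *)
Definition apex (R : realType) (d m : nat) : 'rV[R]_d :=
  \row_(j < d) if (j.+1 < d)%N then q R d j.+1 else (d`! * m)%:R.

Definition S_simplex (R : realType) (d : nat) : nat -> set 'rV[R]_d :=
  match d return nat -> set 'rV[R]_d with
  | 1 => fun m => [set x : 'rV[R]_1 | 0 <= x ord0 ord0 <= m%:R]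
  | d' => fun m =>
      convex_hull ([set 0]
        `|` [set delta_mx ord0 j | j in [set j : 'I_d' | (j.+1 < d')%N]]
        `|` [set apex R d' m])
  end.
Arguments S_simplex : clear implicits.

(* Main.v *)
Require Import Defs.
From mathcomp Require Import all_boot all_order all_algebra all_fingroup finmap.
From mathcomp Require Import boolp classical_sets cardinality reals.
From mathcomp Require Import zify ring lra.

(** Let [d = n + 1], [c i = i! (i + 2)] for [i < n] (so [q_(i+1)(d) = - d! / c i])
and [h k = k - \sum_(i < n) floor (k / c i)].  Since [\sum_i 1 / c i = 1 - 1 / d!],
a lattice point of the [t]-th dilate with last coordinate [y] is given by its
integral slacks [z i = x i + floor (y / (m c i)) >= 0], and the last inequality
becomes [\sum_i z i + g y <= t], where [g y = ceil (y / m) - \sum_i floor (y / (m c i))].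
As [g (y + d! m) = g y + 1], writing [y = k d! m + j] gives
[h^* = \sum_(j < d! m) x^(g j)], and splitting [j] modulo [m] turns this into
[(1 + (m - 1) x) B] with [B = \sum_(k < d!) x^(h k)].
Finally [h k] counts the descents of the factorial-base digits of [k], which form
the Lehmer code of a permutation with the same number of descents; hence
[A_d = x B] and [T = (1 - x) B]. *)

Set Implicit Arguments.
Unset Strict Implicit.
Unset Printing Implicit Defensive.

Import Order.TTheory GRing.Theory Num.Theory.

#[local] Arguments factorial : simpl never.

(** * Removing the leading letter of a permutation *)

(** [lift_perm ord0 a s] is the word [a] followed by the values of [s], relabelled increasingly so
    as to skip [a]. The tail keeps its descents, and its first letter lies below [a] exactly when
    [s ord0 < a]. *)
Lemma des_lift_perm n (a : 'I_n.+2) (s : 'S_n.+1) :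
  des (lift_perm ord0 a s) = des s + (s ord0 < a).
Proof.
have desE k (u : 'S_k) : des u =
    \sum_(j < k) [exists i : 'I_k, (i == j.+1 :> nat) && (u i < u j)].
  by rewrite /des -sum1_card big_mkcond /=; apply: eq_bigr => j _; rewrite inE; case: ifP.
rewrite !desE big_ord_recl addnC; congr (_ + _).
  apply: eq_bigr => j _; congr nat_of_bool; apply/existsP/existsP.
  - case=> i /andP[/eqP iE]; have -> : i = lift ord0 (inord j.+1 : 'I_n.+1).
      apply: val_inj; have := ltn_ord i; rewrite /= iE /bump /= => lt_j.
      by rewrite inordK //; lia.
    rewrite !lift_perm_lift => lt_s; exists (inord j.+1).
    have := ltn_ord i; rewrite iE /= /bump /= => lt_j.
    by rewrite inordK ?eqxx; move: lt_s; rewrite /= /bump; lia.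
  - case=> i /andP[/eqP iE lt_s]; exists (lift ord0 i).
    by rewrite !lift_perm_lift /= /bump iE eqxx; move: lt_s; lia.
congr nat_of_bool; apply/existsP/idP.
  case=> i /andP[/eqP iE]; have -> : i = lift ord0 ord0 by apply: val_inj; rewrite /= iE.
  by rewrite lift_perm_lift lift_perm_id /= /bump; lia.
move=> lt_sa; exists (lift ord0 ord0).
by rewrite lift_perm_lift lift_perm_id /= /bump; lia.
Qed.

(** This is one step of the Lehmer code: a permutation is its leading letter together with the
    standardized rest. *)
Lemma lift_perm0_bij n :
  bijective (fun p : 'I_n.+1 * 'S_n => lift_perm ord0 p.1 p.2).
Proof.
apply: inj_card_bij => [[a s] [b u] /= eq_su|]; last first.
  by rewrite card_prod card_ord !card_Sn factS.
have eq_ab : a = b by rewrite -(lift_perm_id ord0 a s) eq_su lift_perm_id.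
congr pair => //; apply/permP => k; apply: (@lift_inj _ a).
by rewrite -(lift_perm_lift ord0) eq_su lift_perm_lift eq_ab.
Qed.

(** * Floor sums and the factorial number system *)

Definition cden (i : nat) := i`! * i.+2.

Lemma cden_gt0 i : 0 < cden i. Proof. by rewrite muln_gt0 fact_gt0. Qed.

Lemma cdenE i : cden i = (i.+1)`! + i`!.
Proof. by rewrite /cden factS; lia. Qed.

Lemma cdenM i : cden i * i.+1 = (i.+2)`!.
Proof. by rewrite /cden !factS; lia. Qed.

(** [cden i] divides [(i+2)!]. This makes the [q] entries integral and the floors below exactly
    additive under shifts by multiples of [(n+1)!]. *)
Lemma dvdn_cden i n : i < n -> cden i %| (n.+1)`!.
Proof.
move=> lt_in; apply: (@dvdn_trans (i.+2)`!); first by rewrite -cdenM dvdn_mulr.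
rewrite -ltnS in lt_in; elim: n lt_in => // n IHn.
by rewrite ltnS leq_eqVlt => /predU1P[->//|/IHn dv]; rewrite (factS n.+1) dvdn_mull.
Qed.

(* The telescoping sum of [1 / i! - 1 / (i + 1)!], scaled by [(n + 1)!]. *)
Lemma sum_fact_div_cden n : (\sum_(i < n) (n.+1)`! %/ cden i).+1 = (n.+1)`!.
Proof.
elim: n => [|n IHn]; first by rewrite big_ord0.
have -> : (n.+2)`! = n.+2 * (n.+1)`! by [].
rewrite -{2}IHn big_ord_recr /=.
rewrite (eq_bigr (fun i : 'I_n => n.+2 * ((n.+1)`! %/ cden i))); last first.
  by move=> i _; rewrite muln_divA ?dvdn_cden.
rewrite -big_distrr /= -factS -cdenM mulKn ?cden_gt0 //; lia.
Qed.

Definition floor_sum n k := \sum_(i < n) k %/ cden i.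

(** The shift adds [a (n+1)! / c i] to each floor, in total [a ((n+1)! - 1)]; [a] stands on the left
    to avoid truncated subtraction. *)
Lemma floor_sumD n a k :
  floor_sum n (a * (n.+1)`! + k) + a = a * (n.+1)`! + floor_sum n k.
Proof.
rewrite -{2}sum_fact_div_cden mulnS /floor_sum.
rewrite (eq_bigr (fun i : 'I_n => a * ((n.+1)`! %/ cden i) + k %/ cden i)).
  by rewrite big_split /= -big_distrr /=; lia.
move=> i _; have dv := dvdn_cden (ltn_ord i).
by rewrite divnDl ?muln_divA // dvdn_mull.
Qed.

(** The floors are at most [k / c i], whose sum is [k (1 - 1 / (n+1)!)]; the proof clears the
    denominator [(n+1)!]. *)
Lemma floor_sum_lt n k : 0 < k -> floor_sum n k < k.
Proof.
move=> k_gt0; rewrite -(ltn_pmul2l (fact_gt0 n.+1)) big_distrr /=.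
apply: (@leq_ltn_trans (\sum_(i < n) ((n.+1)`! %/ cden i) * k)); last first.
  by rewrite -big_distrl ltn_pmul2r //= -[X in _ < X]sum_fact_div_cden.
apply: leq_sum => i _.
rewrite -{1}(divnK (dvdn_cden (ltn_ord i))) -mulnA leq_mul2l mulnC leq_trunc_div.
by rewrite orbT.
Qed.

Lemma floor_sum_le n k : floor_sum n k <= k.
Proof.
case: k => [|k]; last exact/ltnW/floor_sum_lt.
by rewrite /floor_sum big1 // => i _; rewrite div0n.
Qed.

(* In the factorial number system the height of [k] is the number of strict
   descents of its digits, read from the leading one. *)
Definition height n k := k - floor_sum n k.

Lemma heightD n a k : height n (a * (n.+1)`! + k) = a + height n k.
Proof.
have := floor_sumD n a k; have := floor_sum_le n k.
have := floor_sum_le n (a * (n.+1)`! + k); rewrite /height.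
move: (a * _) => x; move: (floor_sum n k) (floor_sum n (x + k)) => *; lia.
Qed.

(** Let [b = k %/ n!] be the leading digit of [k]. The new floor is that of [(a (n+1) + b) / (n+2) =
    a + (b - a) / (n+2)], which is [a] if [b >= a] and [a - 1] otherwise; so prepending [a] adds 1
    exactly at a descent. *)
Lemma height_recr n a k : a < n.+2 -> k < (n.+1)`! ->
  height n.+1 (a * (n.+1)`! + k) = height n k + (k %/ n`! < a).
Proof.
move=> lt_a lt_k; have lt_b : k %/ n`! < n.+1 by rewrite ltn_divLR ?fact_gt0.
have xE : (a * (n.+1)`! + k) %/ cden n = a - (k %/ n`! < a).
  rewrite /cden divnMA factS mulnA divnMDl ?fact_gt0 //.
  move: (k %/ n`!) lt_b => b lt_b; case: ltnP => [lt_ba|le_ab].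
    case: a lt_a lt_ba => // a' lt_a lt_ba; rewrite subn1 /=.
    have -> : a'.+1 * n.+1 + b = a' * n.+2 + (n.+1 - a' + b) by rewrite mulSn !mulnS; lia.
    by rewrite divnMDl // divn_small ?addn0 //; lia.
  have -> : a * n.+1 + b = a * n.+2 + (b - a) by rewrite !mulnS; lia.
  by rewrite divnMDl // divn_small ?addn0 ?subn0 //; lia.
have := floor_sumD n a k; have := floor_sum_le n k.
rewrite /height; have := floor_sum_le n.+1 (a * (n.+1)`! + k).
have -> : floor_sum n.+1 (a * (n.+1)`! + k)
    = floor_sum n (a * (n.+1)`! + k) + (a - (k %/ n`! < a)).
  by rewrite /floor_sum big_ord_recr /= xE.
(* If [b < a] then [a] is positive, so the truncated [a - 1] is exact. *)
case: ltnP => [/(leq_ltn_trans (leq0n _)) a_gt0|_] /=; clear xE lt_b lt_k;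
  move: (a * _) => x; move: (floor_sum n k) (floor_sum n (x + k)) => *; lia.
Qed.

(** [F] also receives the leading digit, matched with the first letter [s ord0]: both recurrences
    compare the new leading entry with the previous one, so the induction must remember it. *)
Lemma sum_height_des (V : nmodType) n (F : nat -> nat -> V) :
  (\sum_(k < (n.+1)`!) F (k %/ n`!)%N (height n k)
   = \sum_(s : 'S_n.+1) F (s ord0) (des s))%R.
Proof.
elim: n F => [|n IHn] F.
  rewrite big_ord_recl big_ord0 addr0.
  rewrite (big_pred1 1%g) => [|s]; last first.
    by symmetry; apply/eqP/permP => x; rewrite !ord1.
  rewrite perm1 /height /des; congr F.
  apply/esym/eqP; rewrite cards_eq0; apply/eqP/setP => j.
  by rewrite !inE; apply/existsP => -[i]; rewrite !ord1.
rewrite (reindex _ (onW_bij _ (lift_perm0_bij n.+1))) /=.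
rewrite -(pair_bigA _ (fun a s => F (lift_perm ord0 a s ord0) (des (lift_perm ord0 a s)))) /=.
rewrite -(big_mkord xpredT (fun k => F (k %/ (n.+1)`!) (height n.+1 k))) factS big_nat_mul big_mkord.
apply: eq_bigr => a _.
under [RHS]eq_bigr => s _ do rewrite lift_perm_id des_lift_perm.
rewrite -(IHn (fun b h => F a (h + (b < a)))).
rewrite -[X in index_iota X]add0n big_addn mulSn addnK big_mkord.
apply: eq_bigr => k _.
by rewrite addnC height_recr // divnMDl ?fact_gt0 // divn_small // addn0.
Qed.

(** This is [g y] of the overview, since [floor (y / (m c i))] is the floor of [(y %/ m) / c i] and
    the boolean rounds [y / m] up. *)
Definition lheight n m y := height n (y %/ m) + (y %% m != 0).

(** * Counting tuples of bounded sum *)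

(** A sum at most [r] bounds every entry by [r], so enlarging the entry range to [t] adds no tuple.
    One tuple type thus serves all the bounds [r = t - g j]. *)
Lemma card_bounded_tuples d r t : r <= t ->
  #|[set w : d.-tuple 'I_t.+1 | \sum_(i < d) tnth w i <= r]| = 'C(d + r, d).
Proof.
move=> le_rt; have le_rt1 : r.+1 <= t.+1 by [].
pose wid := map_tuple (widen_ord le_rt1) : d.-tuple _ -> d.-tuple _.
have wid_inj : injective wid.
  move=> u v /(congr1 val)/= /inj_map eq_uv; apply/val_inj/eq_uv => x y /(congr1 val)/=.
  exact: val_inj.
rewrite -card_partial_ord_partitions -(card_imset _ wid_inj); congr #|pred_of_set _|.
apply/setP => w; rewrite inE; apply/idP/imsetP => [le_w|[u]]; last first.
  rewrite inE big_tuple => le_u ->; apply: leq_trans le_u; apply: leq_sum => i _.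
  by rewrite tnth_map.
have le_wi i : tnth w i < r.+1.
  by rewrite ltnS (leq_trans _ le_w) // (bigD1 i) //= leq_addr.
exists [tuple inord (tnth w i) | i < d].
  rewrite inE big_tuple; apply: leq_trans le_w; apply: leq_sum => i _.
  by rewrite tnth_mktuple inordK.
apply/eq_from_tnth => i; apply: val_inj.
by rewrite tnth_map tnth_mktuple /= inordK.
Qed.

Lemma card_lattice_code d N t (g : nat -> nat) :
  #|[set p : 'I_N * d.-tuple 'I_t.+1 | \sum_(i < d) tnth p.2 i + g p.1 <= t]|
  = \sum_(j < N) if g j <= t then 'C(d + (t - g j), d) else 0.
Proof.
pose P (j : 'I_N) (w : d.-tuple 'I_t.+1) := \sum_(i < d) tnth w i + g j <= t.
transitivity (\sum_(p : 'I_N * d.-tuple 'I_t.+1) P p.1 p.2 : nat).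
  rewrite -sum1_card big_mkcond /=; apply: eq_bigr => p _.
  by rewrite inE -/(P p.1 p.2); case: ifP.
rewrite -(pair_bigA _ (fun j w => P j w : nat)) /=.
apply: eq_bigr => j _; case: ifP => le_gt; last first.
  apply: big1 => w _; apply/eqP; rewrite eqb0 -ltnNge.
  by rewrite (leq_trans _ (leq_addl _ _)) // ltnNge le_gt.
rewrite -(@card_bounded_tuples d (t - g j) t) ?leq_subr // -sum1_card [RHS]big_mkcond.
by apply: eq_bigr => w _; rewrite inE /P leq_subRL // addnC; case: ifP.
Qed.

Local Open Scope ring_scope.

(** * Formal power series through their coefficients *)

(** Coefficient of [x^n] in the product of [p] and the power series with coefficients [u]; only the
    truncation of the series at degree [n] matters. *)
Definition conv (p : {poly int}) (u : nat -> int) n :=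
  \sum_(k < n.+1) p`_k * u (n - k)%N.

Lemma convE p u n : conv p u n = (p * \poly_(i < n.+1) u i)`_n.
Proof.
rewrite coefM; apply: eq_bigr => k _; rewrite coef_poly ltnS leq_subr //.
Qed.

(** Coefficients of [(1 - x)] times the series of [u]. *)
Definition bdiff (u : nat -> int) n := u n - if n is n'.+1 then u n' else 0.

Lemma conv_bdiff p u n : conv ((1 - 'X) * p) u n = conv p (bdiff u) n.
Proof.
rewrite convE mulrAC mulrC coefM; apply: eq_bigr => k _; congr (_ * _).
rewrite mulrBl mul1r coefB coefXM !coef_poly ltnS leq_subr /bdiff.
by case: (n - k)%N (leq_subr k n) => [|j] //= lt_jn; rewrite ltnS ltnW.
Qed.

(** Coefficients of [x^g / (1 - x)^(d + 1)]. *)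
Definition bin_series d g t : int := if (g <= t)%N then 'C(d + (t - g), d)%:Z else 0.

(** Pascal's rule, away from the boundary case [n = g]. *)
Lemma bdiff_bin_series d g n :
  bdiff (bin_series d.+1 g) n = bin_series d g n.
Proof.
rewrite /bdiff /bin_series; case: n => [|n].
  by rewrite subr0; case: g => //; rewrite !addn0 !binn.
case: (ltngtP g n.+1) => [|lt_ng|->]; last by rewrite ltnn subnn !addn0 !binn subr0.
  rewrite ltnS => le_gn; rewrite le_gn subSn // !addSn !addnS binS PoszD; ring.
by rewrite leqNgt (ltnW lt_ng) subr0.
Qed.

(** Each factor [1 - x] lowers [d] by one; the last one differentiates the unit step at [g]. *)
Lemma conv_bin_series d g n :
  conv ((1 - 'X) ^+ d.+1) (bin_series d g) n = (n == g)%:R.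
Proof.
elim: d => [|d IHd]; last first.
  rewrite exprS conv_bdiff -IHd; apply: eq_bigr => k _.
  by rewrite bdiff_bin_series.
rewrite expr1 -[1 - _]mulr1 conv_bdiff /conv big_ord_recl big1 => [|k _]; last first.
  by rewrite coef1 mul0r.
rewrite coef1 mul1r addr0 subn0 /bdiff /bin_series; case: n => [|n].
  by case: g => [|g]; rewrite ?subr0 ?bin0.
by rewrite !bin0; case: (ltngtP g n.+1) => [|lt_ng|->]; rewrite ?ltnS;
  [move=> ->; rewrite subrr|rewrite leqNgt (ltnW lt_ng) subr0|rewrite ltnn subr0].
Qed.

(** * The numerator and the Eulerian polynomial *)

(** By [floor_sum_lt] a positive quotient has positive height. Hence only [j = 0] contributes to the
    series at [t = 0], which gives the constant term 1. *)
Lemma lheight_eq0 n m y : (0 < m)%N -> (lheight n m y == 0%N) = (y == 0%N).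
Proof.
move=> m_gt0; apply/idP/eqP => [|->]; last first.
  by rewrite /lheight div0n mod0n /height sub0n.
rewrite /lheight addn_eq0 eqb0 negbK => /andP[h0 /eqP ym].
have [q0|/(floor_sum_lt n)] := posnP (y %/ m); last by rewrite -subn_gt0 lt0n h0.
by rewrite (divn_eq y m) ym q0.
Qed.

Lemma sum_bin_series0 d N (g : nat -> nat) : (0 < N)%N ->
  (forall j, (g j == 0%N) = (j == 0%N)) -> \sum_(j < N) bin_series d (g j) 0 = 1.
Proof.
case: N => // N _ g0; rewrite big_ord_recl big1 => [|j _].
  by rewrite /bin_series leqn0 g0 eqxx sub0n addn0 binn.
by rewrite /bin_series leqn0 g0.
Qed.

Definition des_poly n : {poly int} := \sum_(k < (n.+1)`!) 'X^(height n k).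

Lemma des_polyE n : des_poly n = \sum_(s : 'S_n.+1) 'X^(des s).
Proof. exact: (sum_height_des n (fun _ h => 'X^h)). Qed.

Lemma eulerian_polyE n : eulerian_poly n.+1 = 'X * des_poly n.
Proof. by rewrite des_polyE big_distrr; apply: eq_bigr => s _; rewrite add1n exprS. Qed.

(** The last position has no successor, hence is never a descent; this bounds the degree of
    [des_poly]. *)
Lemma des_le n (s : 'S_n.+1) : (des s <= n)%N.
Proof.
suff sub : [set j : 'I_n.+1 | [exists k : 'I_n.+1, (k == j.+1 :> nat) && (s k < s j)%N]]
    \subset [set~ ord_max].
  by apply: leq_trans (subset_leq_card sub) _; rewrite cardsC1 card_ord.
apply/fintype.subsetP => j; rewrite !inE => /existsP[k /andP[/eqP kE _]].
by apply/eqP => jE; have := ltn_ord k; rewrite kE jE ltnn.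
Qed.

Lemma size_des_poly n : (size (des_poly n) <= n.+1)%N.
Proof.
rewrite des_polyE; apply: (leq_trans (size_sum _ _ _)); apply/bigmax_leqP => s _.
by rewrite size_polyXn ltnS des_le.
Qed.

(** Write [j = k m + r] with [r < m]: [r = 0] contributes [x^(height n k)] and each of the other
    [m - 1] residues one more factor [x]. Then [(1 + (m - 1) x) B = m x B + (1 - x) B]. *)
Lemma sum_lheight n m : (0 < m)%N ->
  \sum_(j < (n.+1)`! * m) 'X^(lheight n m j)
  = m%:R *: eulerian_poly n.+1 + (1 - 'X) * des_poly n.
Proof.
case: m => // m _; rewrite eulerian_polyE.
rewrite -(big_mkord xpredT (fun j => 'X^(lheight n m.+1 j))) big_nat_mul big_mkord.
rewrite (eq_bigr (fun k : 'I_(n.+1)`! => 'X^(height n k) * (1 + m%:R *: 'X))).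
  by rewrite -big_distrl /= -/(des_poly n) -!mul_polyC -natr1; ring.
move=> k _; rewrite -[X in index_iota X]add0n big_addn mulSn addnK big_mkord.
rewrite big_ord_recl (eq_bigr (fun=> 'X^(height n k) * 'X)); last first.
  move=> r _; rewrite /lheight (addnC _ (k * m.+1)%N) divnMDl // modnMDl divn_small ?ltn_ord //.
  by rewrite modn_small ?ltn_ord //= addn0 addn1 exprSr.
rewrite /lheight add0n mulnK // modnMl addn0 sumr_const card_ord.
by rewrite scaler_nat mulrDr mulr1 -mulrnAr.
Qed.

(* The series of [t |-> \sum_j bin_series d (g j) t] is
   [(\sum_j 'X^(g j)) / (1 - 'X)^(d + 1)]. *)
Lemma hstar_of_bin_series (R : realType) d (P : set 'rV[R]_d) N (g : nat -> nat) :
  (forall t, ehrhart_series P t = \sum_(j < N) bin_series d (g j) t) ->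
  forall n, (\sum_(j < N) 'X^(g j) : {poly int})`_n
    = \sum_(k < n.+1) ((1 - 'X) ^+ d.+1)`_k * ehrhart_series P (n - k).
Proof.
move=> PE n; rewrite coef_sum.
under [RHS]eq_bigr => k _ do rewrite PE big_distrr /=.
by rewrite exchange_big /=; apply: eq_bigr => j _; rewrite coefXn -(conv_bin_series d).
Qed.

Local Open Scope classical_set_scope.

(** * Barycentric coordinates and facets of the simplex *)

Lemma qE (R : realType) d i : q R d i.+1 = - (d`!)%:R / (cden i)%:R.
Proof. by rewrite /q cdenE. Qed.

(** Telescoping: [1 / c i = 1 / (i+1)! - 1 / (i+2)!]. *)
Lemma sum_inv_cden (R : realType) n :
  \sum_(i < n) (cden i)%:R^-1 = 1 - (n.+1)`!%:R^-1 :> R.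
Proof.
elim: n => [|n IHn]; first by rewrite big_ord0 invr1 subrr.
rewrite big_ord_recr /= IHn.
have cE : (n.+1)`!%:R = (n.+1)%:R * n`!%:R :> R by rewrite factS natrM.
have dE : (n.+2)`!%:R = (n.+2)%:R * (n.+1)%:R * n`!%:R :> R by rewrite !factS !natrM mulrA.
have fn0 : n`!%:R != 0 :> R by rewrite pnatr_eq0 -lt0n fact_gt0.
rewrite dE cE /cden natrM -!natr1.
have n_ge0 : 0 <= n%:R :> R by [].
move: (n%:R) (n`!%:R) n_ge0 fn0 => x y x_ge0 y0.
by field; rewrite y0 /=; apply/andP; split; lra.
Qed.

(** Coordinates of [x] in the basis of nonzero vertices. The apex has weight [y / (d! m)], with [y]
    the last entry of [x]; subtracting its share [- y / (m c j)] from entry [j] leaves the weight of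
    the [j]-th unit vector. *)
Definition bary (R : realType) n m (x : 'rV[R]_n.+1) (j : 'I_n.+1) : R :=
  if (j < n)%N then x ord0 j + x ord0 ord_max / (m * cden j)%:R
  else x ord0 ord_max / ((n.+1)`! * m)%:R.

Definition simplex_edge (R : realType) n m (j : 'I_n.+1) : 'rV[R]_n.+1 :=
  if (j < n)%N then delta_mx ord0 j else apex R n.+1 m.

Definition simplex_vertex (R : realType) n m (i : 'I_n.+2) : 'rV[R]_n.+1 :=
  if unlift ord0 i is Some j then simplex_edge R m j else 0.

Lemma ord_maxE n (j : 'I_n.+1) : (j < n)%N = false -> j = ord_max.
Proof. by move=> jn; apply: val_inj => /=; have := ltn_ord j; lia. Qed.

Section Geometry.
Variables (R : realType) (n m : nat).
Hypothesis m_gt0 : (0 < m)%N.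
Local Notation baryc := (@bary R n m).
Local Notation edge := (@simplex_edge R n m).
Local Notation vertex := (@simplex_vertex R n m).

Lemma bary_sum k (a : 'I_k -> R) (p : 'I_k -> 'rV[R]_n.+1) j :
  baryc (\sum_i a i *: p i) j = \sum_i a i * baryc (p i) j.
Proof.
rewrite /bary; case: ifP => _.
  rewrite !summxE mulr_suml -big_split /=; apply: eq_bigr => i _.
  by rewrite !mxE; ring.
by rewrite !summxE mulr_suml /=; apply: eq_bigr => i _; rewrite !mxE mulrA.
Qed.

Lemma baryZ a x j : baryc (a *: x) j = a * baryc x j.
Proof. by rewrite /bary; case: ifP => _; rewrite !mxE; ring. Qed.

Lemma natr_cden_neq0 i : (cden i)%:R != 0 :> R.
Proof. by rewrite pnatr_eq0 -lt0n cden_gt0. Qed.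

Lemma natr_fact_neq0 i : i`!%:R != 0 :> R.
Proof. by rewrite pnatr_eq0 -lt0n fact_gt0. Qed.

Lemma natr_m_neq0 : m%:R != 0 :> R.
Proof. by rewrite pnatr_eq0 -lt0n. Qed.

Lemma bary_max x : baryc x ord_max = x ord0 ord_max / ((n.+1)`!%:R * m%:R).
Proof. by rewrite /bary ltnn natrM. Qed.

Lemma bary_widen x (i : 'I_n) (j := widen_ord (leqnSn n) i) :
  baryc x j = x ord0 j + x ord0 ord_max / (m%:R * (cden i)%:R).
Proof. by rewrite /bary (_ : (j < n)%N) ?natrM //; exact: (ltn_ord i). Qed.

Lemma edge_max : edge ord_max = apex R n.+1 m.
Proof. by rewrite /simplex_edge ltnn. Qed.

Lemma edge_widen (i : 'I_n) (j := widen_ord (leqnSn n) i) :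
  edge j = delta_mx ord0 j.
Proof. by rewrite /simplex_edge (_ : (j < n)%N) //; exact: (ltn_ord i). Qed.

Lemma sum_bary_edge x : \sum_j baryc x j *: edge j = x.
Proof.
apply/rowP => k; rewrite -[RHS]/(x ord0 k) summxE big_ord_recr /= bary_max edge_max.
under eq_bigr => i _ do rewrite bary_widen edge_widen !mxE eqxx andTb.
rewrite !mxE ltnS natrM; case: ifP => kn; last first.
  rewrite (ord_maxE kn) big1 => [|i _]; last first.
    by rewrite -val_eqE /= gtn_eqF // mulr0.
  by rewrite add0r divfK // mulf_neq0 ?natr_fact_neq0 ?natr_m_neq0.
rewrite (bigD1 (Ordinal kn)) //= big1 => [|i]; last first.
  by rewrite -!val_eqE /= eq_sym => /negPf ->; rewrite mulr0.
rewrite -val_eqE /= eqxx (_ : widen_ord _ _ = k); last exact: val_inj.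
rewrite mulr1 addr0 qE.
by field; rewrite natr_cden_neq0 natr_fact_neq0 natr_m_neq0.
Qed.

Lemma bary_edge j k : baryc (edge k) j = (j == k)%:R.
Proof.
rewrite /bary /simplex_edge; case: ifP => jn; case: ifP => kn.
- rewrite !mxE !eqxx /= (_ : ord_max == k = false) ?mul0r ?addr0 //.
  by apply/eqP => ke; rewrite -ke ltnn in kn.
- rewrite !mxE !ltnS jn ltnn qE (natrM _ (n.+1)`!) (natrM _ m) (_ : j == k = false); last first.
    by apply/eqP => jk; rewrite jk kn in jn.
  by rewrite mulr0n; field; rewrite natr_cden_neq0 natr_m_neq0.
- rewrite !mxE !eqxx /= (_ : ord_max == k = false); last first.
    by apply/eqP => ke; rewrite -ke ltnn in kn.
  rewrite (_ : j == k = false) ?mul0r //.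
  by apply/eqP => jk; rewrite jk kn in jn.
- rewrite (ord_maxE jn) (ord_maxE kn) eqxx mxE ltnS ltnn natrM divff //.
  by rewrite mulf_neq0 ?natr_fact_neq0 ?natr_m_neq0.
Qed.

Lemma bary0 j : baryc 0 j = 0.
Proof. by rewrite -(scale0r 0) baryZ mul0r. Qed.

(** The [1 / c i] sum to [1 - 1 / d!], and the apex weight supplies the missing [1 / d!]: this is
    what the choice of the [q] achieves. *)
Lemma sum_bary x :
  \sum_j baryc x j = \sum_(i < n) x ord0 (widen_ord (leqnSn n) i) + x ord0 ord_max / m%:R.
Proof.
rewrite big_ord_recr /= bary_max.
under eq_bigr => i _ do rewrite bary_widen invfM mulrA.
rewrite big_split /= -big_distrr /= -addrA sum_inv_cden; congr (_ + _).
by field; rewrite natr_fact_neq0 natr_m_neq0.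
Qed.

Lemma vertex0 : vertex ord0 = 0.
Proof. by rewrite /simplex_vertex unlift_none. Qed.

Lemma vertex_lift j : vertex (lift ord0 j) = edge j.
Proof. by rewrite /simplex_vertex liftK. Qed.

(** The coordinates are linear, so the inequalities pass from the vertices to convex
    combinations. *)
Lemma mem_simplex x : convex_hull (range vertex) x <->
  (forall j, 0 <= baryc x j) /\ \sum_j baryc x j <= 1.
Proof.
split=> [[k [a [p [a_ge0 a_sum pV ->]]]]|[b_ge0 b_le1]].
  have bp i : (forall j, 0 <= baryc (p i) j) /\ \sum_j baryc (p i) j <= 1.
    have [v _ <-] := pV i; case: (unliftP ord0 v) => [j ->|->].
      rewrite vertex_lift; split=> [j'|]; first by rewrite bary_edge ler0n.
      rewrite (bigD1 j) //= big1 ?bary_edge ?eqxx ?addr0 // => j' jj'.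
      by rewrite bary_edge (negPf jj').
    by rewrite vertex0; split=> [j|]; rewrite ?bary0 // big1 // => j _; rewrite bary0.
  split=> [j|].
    by rewrite bary_sum sumr_ge0 // => i _; rewrite mulr_ge0 //; case: (bp i).
  under eq_bigr => j _ do rewrite bary_sum.
  rewrite exchange_big /= -a_sum; apply: ler_sum => i _.
  by rewrite -big_distrr /= ler_piMr //; case: (bp i).
(* Conversely, the coordinates serve as weights and the origin takes the remainder. *)
exists n.+2, (fun i => if unlift ord0 i is Some j then baryc x j else 1 - \sum_j baryc x j).
exists vertex; split.
- by move=> i; case: unlift => // ; rewrite subr_ge0.
- rewrite big_ord_recl unlift_none [X in _ + X](eq_bigr (bary m x)) ?subrK // => j _.
  by rewrite liftK.
- by move=> i; exists i.
- rewrite big_ord_recl vertex0 scaler0 add0r -{1}(sum_bary_edge x).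
  by apply: eq_bigr => j _; rewrite liftK vertex_lift.
Qed.

Lemma vertex_int i : vertex i \is a mxOver Num.int.
Proof.
apply/mxOverP => k j; rewrite ord1 {k}; case: (unliftP ord0 i) => [l ->|->]; last first.
  by rewrite vertex0 mxE.
rewrite vertex_lift /simplex_edge; case: ifP => _; rewrite mxE ?natr_int //.
rewrite ltnS; case: ifP => jn; rewrite ?natr_int // qE mulNr rpredN.
by rewrite -(divnK (dvdn_cden jn)) natrM mulfK ?natr_cden_neq0 ?natr_int.
Qed.

(** Applying the [j]-th coordinate to a vanishing combination isolates the coefficient of the [j]-th
    edge; that of the origin then follows from the zero sum. *)
Lemma vertex_affinely_independent : affinely_independent vertex.
Proof.
move=> a a0 av0; have al j : a (lift ord0 j) = 0.
  have := congr1 (fun x => baryc x j) av0.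
  rewrite bary_sum bary0 big_ord_recl vertex0 bary0 mulr0 add0r.
  rewrite (bigD1 j) //= big1 => [|k kj]; last first.
    by rewrite vertex_lift bary_edge eq_sym (negPf kj) mulr0.
  by rewrite vertex_lift bary_edge eqxx mulr1 addr0.
move=> i; case: (unliftP ord0 i) => [j ->//|->].
by move: a0; rewrite big_ord_recl big1 ?addr0.
Qed.

End Geometry.

Lemma S_simplexE (R : realType) n m : (0 < m)%N ->
  S_simplex R n.+1 m = convex_hull (range (@simplex_vertex R n m)).
Proof.
move=> m_gt0; case: n => [|n].
  (* In dimension 1 the simplex is given as an interval, and the only coordinate is [x / m]. *)
  apply/seteqP; split=> x /=.
    move=> /andP[x_ge0 x_le]; apply/(mem_simplex m_gt0).
    rewrite big_ord_recl big_ord0 addr0 /bary ltnn /= mul1n.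
    have -> : ord_max = ord0 :> 'I_1 by exact: val_inj.
    split=> [j|]; first by rewrite ord1 divr_ge0.
    by rewrite ler_pdivrMr ?mul1r ?ltr0n.
  move=> /(mem_simplex m_gt0)[/(_ ord0)].
  rewrite big_ord_recl big_ord0 addr0 /bary ltnn /= mul1n.
  have -> : ord_max = ord0 :> 'I_1 by exact: val_inj.
  by rewrite ler_pdivrMr ?mul1r ?pmulr_lge0 ?invr_gt0 ?ltr0n // => -> ->.
congr convex_hull; apply/seteqP; split=> x.
  case=> [[->|[j /= jn <-]]|->].
  - by exists ord0; rewrite ?vertex0.
  - by exists (lift ord0 j); rewrite ?vertex_lift // /simplex_edge -ltnS jn.
  - by exists (lift ord0 ord_max); rewrite ?vertex_lift ?edge_max.
case=> i _ <-; case: (unliftP ord0 i) => [j ->|->]; last by rewrite vertex0; left; left.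
rewrite vertex_lift /simplex_edge; case: ifP => jn; last by right.
by left; right; exists j.
Qed.

(** * Lattice points and integral slacks *)

(** As [s] and [k] are integers, rounding [y / m] up does not affect the inequality
    [s + y / m <= k]. *)
Lemma ceil_div_le m y s k : (0 < m)%N ->
  (s + (y %/ m + (y %% m != 0)) <= k)%N = (s * m + y <= k * m)%N.
Proof.
move=> m_gt0; rewrite addnA.
have -> : (s * m + y = (s + y %/ m) * m + y %% m)%N by rewrite mulnDl -addnA -divn_eq.
have := ltn_pmod y m_gt0; move: (y %% m)%N (s + y %/ m)%N => r a lt_rm.
case: r lt_rm => [|r] lt_rm; first by rewrite !addn0 leq_pmul2r.
rewrite /= addn1; apply/idP/idP => [lt_ak|le_k].
  by apply: leq_trans (leq_mul lt_ak (leqnn m)); rewrite mulSn addnC leq_add2r ltnW.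
rewrite ltnNge; apply/negP => le_ka.
by have := leq_trans le_k (leq_mul le_ka (leqnn m)); rewrite leqNgt addnS ltnS leq_addr.
Qed.

Lemma lheightD n m j k : (0 < m)%N ->
  lheight n m (k * ((n.+1)`! * m) + j) = (k + lheight n m j)%N.
Proof.
by move=> m_gt0; rewrite /lheight mulnA divnMDl // modnMDl heightD addnA.
Qed.

Lemma lheightE n m y :
  (lheight n m y + floor_sum n (y %/ m) = y %/ m + (y %% m != 0))%N.
Proof. by rewrite /lheight /height addnAC subnK ?floor_sum_le. Qed.

(* The lattice point with last coordinate [y] and slacks [z i] in the other
   coordinates, the [z] of index [n] being ignored. *)
Definition lattice_point (R : realType) n m y (z : 'I_n.+1 -> nat) : 'rV[R]_n.+1 :=
  \row_(i < n.+1) if (i < n)%N then (z i)%:R - (y %/ (m * cden i))%:R else y%:R.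

Section Lattice.
Variables (R : realType) (n m : nat).
Hypothesis m_gt0 : (0 < m)%N.
Local Notation point := (@lattice_point R n m).

Lemma point_max y z : point y z ord0 ord_max = y%:R.
Proof. by rewrite mxE ltnn. Qed.

Lemma point_widen y z (i : 'I_n) (j := widen_ord (leqnSn n) i) :
  point y z ord0 j = (z j)%:R - (y %/ (m * cden i))%:R.
Proof. by rewrite mxE (_ : (j < n)%N) //; exact: (ltn_ord i). Qed.

Lemma point_int y z : point y z \is a mxOver Num.int.
Proof.
by apply/mxOverP => k i; rewrite mxE; case: ifP => _; rewrite ?rpredB ?natr_int.
Qed.

Lemma bary_point_ge0 y z j : 0 <= bary m (point y z) j.
Proof.
rewrite /bary point_max; case: ifP => jn; last by rewrite divr_ge0.
rewrite mxE jn -addrA addr_ge0 // addrC subr_ge0.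
have c_gt0 : (0 < m * cden j)%N by rewrite muln_gt0 m_gt0 cden_gt0.
by rewrite ler_pdivlMr ?ltr0n // -natrM ler_nat leq_trunc_div.
Qed.

Lemma sum_bary_point_le y z (t : nat) : (\sum_j bary m (point y z) j <= t%:R)
  = (\sum_(i < n) z (widen_ord (leqnSn n) i) + lheight n m y <= t)%N.
Proof.
rewrite sum_bary // point_max.
under eq_bigr => i _ do rewrite point_widen divnMA.
rewrite sumrB -!natr_sum -/(floor_sum n (y %/ m)).
set s := (\sum_(i < n) _)%N; rewrite -(leq_add2r (floor_sum n (y %/ m))) -addnA lheightE.
rewrite ceil_div_le // addrAC lerBlDr -(@ler_pM2r _ m%:R) ?ltr0n //.
by rewrite mulrDl divfK ?pnatr_eq0 -?lt0n // -natrD -!natrM -natrD ler_nat.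
Qed.

(** An integer [x i >= - y / (m c i)] is already at least [- floor (y / (m c i))], so its slack is a
    natural number. *)
Lemma pointP x : x \is a mxOver Num.int -> (forall j, 0 <= bary m x j) ->
  exists y z, x = point y z.
Proof.
move=> /mxOverP x_int b_ge0.
have N_gt0 : 0 < ((n.+1)`! * m)%:R :> R by rewrite ltr0n muln_gt0 fact_gt0.
have /natrP[y yE] : x ord0 ord_max \is a Num.nat.
  rewrite natrEint x_int /=; have := b_ge0 ord_max.
  by rewrite /bary ltnn pmulr_lge0 ?invr_gt0.
have zP (i : 'I_n.+1) : exists z : nat, (i < n)%N ->
    x ord0 i = z%:R - (y %/ (m * cden i))%:R.
  case: (boolP (i < n)%N) => iN; last by exists 0%N.
  suff /natrP[z zE] : x ord0 i + (y %/ (m * cden i))%:R \is a Num.nat.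
    by exists z => _; rewrite -zE addrK.
  rewrite natrEint rpredD ?x_int ?natr_int //=.
  have c_gt0 : (0 < m * cden i)%N by rewrite muln_gt0 m_gt0 cden_gt0.
  have := b_ge0 i; rewrite /bary iN yE.
  have /intrP[a ->] := x_int ord0 i.
  rewrite -(@pmulr_lge0 _ (m * cden i)%:R) ?ltr0n // mulrDl divfK; last first.
    by rewrite pnatr_eq0 -lt0n.
  case: a => a; first by move=> _; rewrite addr_ge0.
  rewrite NegzE mulrNz mulNr addrC subr_ge0 -natrM ler_nat => le_ay.
  by rewrite addrC subr_ge0 ler_nat leq_divRL.
exists y, (fun i => sval (cid (zP i))); apply/rowP => i; rewrite mxE -[LHS]/(x ord0 i).
case: ifP => iN; first by case: cid => z /= ->.
by rewrite (ord_maxE iN).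
Qed.

Lemma point_inj y z y' z' : point y z = point y' z' ->
  y = y' /\ forall i : 'I_n.+1, (i < n)%N -> z i = z' i.
Proof.
move=> eq_p; have yy' : y = y'.
  by have /eqP := congr1 (fun x : 'rV_n.+1 => x ord0 ord_max) eq_p; rewrite !point_max eqr_nat => /eqP.
split=> // i iN; have := congr1 (fun x : 'rV_n.+1 => x ord0 i) eq_p.
by rewrite !mxE iN yy' => /addIr/eqP; rewrite eqr_nat => /eqP.
Qed.

End Lattice.

(** * Counting the lattice points of a dilate *)

Section Ehrhart.
Variables (R : realType) (n m t : nat).
Hypotheses (m_gt0 : (0 < m)%N) (t_gt0 : (0 < t)%N).
Let N := ((n.+1)`! * m)%N.

(** The last tuple entry, ignored as a slack, carries the quotient of [y] by [N]. By [lheightD] it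
    adds to the height just as a slack adds to the sum, so all [n + 1] entries enter the inequality
    alike. *)
Definition decode (p : 'I_N * n.+1.-tuple 'I_t.+1) : 'rV[R]_n.+1 :=
  lattice_point R m (tnth p.2 ord_max * N + p.1) (fun i => tnth p.2 i).

Lemma decode_inj : injective decode.
Proof.
move=> [j w] [j' w'] /point_inj /= [eq_y eq_w].
have [eq_max eq_j] : tnth w ord_max = tnth w' ord_max /\ j = j'.
  have N_gt0 : (0 < N)%N by rewrite muln_gt0 fact_gt0.
  split; apply: val_inj => /=.
    by have := congr1 (divn^~ N) eq_y; rewrite !divnMDl // !divn_small // !addn0.
  by have := congr1 (modn^~ N) eq_y; rewrite !modnMDl !modn_small.
congr pair => //; apply/eq_from_tnth => i.
case: (boolP (i < n)%N) => [iN|/negPf/ord_maxE -> //].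
by apply: val_inj; exact: eq_w.
Qed.

Lemma dilate_simplexE :
  [set t%:R *: x | x in convex_hull (range (@simplex_vertex R n m))]
    `&` [set x : 'rV[R]_n.+1 | x \is a mxOver Num.int]
  = decode @` [set` [set p : 'I_N * n.+1.-tuple 'I_t.+1 |
       (\sum_(i < n.+1) tnth p.2 i + lheight n m p.1 <= t)%N]%SET].
Proof.
have t_neq0 : t%:R != 0 :> R by rewrite pnatr_eq0 -lt0n.
have decode_le (j : 'I_N) (w : n.+1.-tuple 'I_t.+1) :
    (\sum_i bary m (decode (j, w)) i <= t%:R)
    = (\sum_(i < n.+1) tnth w i + lheight n m j <= t)%N.
  by rewrite sum_bary_point_le // lheightD // addnA big_ord_recr.
apply/seteqP; split=> x /=.
  case=> -[u /(mem_simplex m_gt0)[u_ge0 u_le1] <-] x_int.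
  have [j|y [z xE]] := pointP m_gt0 x_int; first by rewrite baryZ mulr_ge0.
  have : \sum_j bary m (t%:R *: u) j <= t%:R.
    by under eq_bigr => j _ do rewrite baryZ; rewrite -big_distrr /= ler_piMr.
  rewrite xE sum_bary_point_le // => le_z.
  have N_gt0 : (0 < N)%N by rewrite muln_gt0 fact_gt0.
  pose w0 (i : 'I_n.+1) := if (i < n)%N then z i else (y %/ N)%N.
  have w0E : (\sum_(i < n.+1) w0 i + lheight n m (y %% N) <= t)%N.
    rewrite big_ord_recr /= {2}/w0 ltnn -addnA -lheightD // -divn_eq.
    apply: leq_trans le_z; rewrite leq_add2r; apply: leq_sum => i _.
    by rewrite /w0 (ltn_ord i).
  (* The entries are nonnegative with sum at most [t], hence fit in ['I_t.+1]. *)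
  have w0_lt i : (w0 i < t.+1)%N.
    by rewrite ltnS (leq_trans _ w0E) // (bigD1 i) //= -addnA leq_addr.
  exists (Ordinal (ltn_pmod y N_gt0), [tuple inord (w0 i) | i < n.+1]).
    rewrite inE /=; under eq_bigr => i _ do rewrite tnth_mktuple inordK //.
    exact: w0E.
  rewrite /decode /= tnth_mktuple inordK // {1}/w0 ltnn -divn_eq.
  by apply/rowP => i; rewrite !mxE; case: ifP => iN; rewrite // tnth_mktuple inordK // /w0 iN.
case=> -[j w]; rewrite /= inE /= -decode_le => le_t <-; split; last exact: point_int.
exists (t%:R^-1 *: decode (j, w)); last by rewrite scalerA divff // scale1r.
apply/(mem_simplex m_gt0); split=> [i|].
  by rewrite baryZ mulr_ge0 ?invr_ge0 // bary_point_ge0.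
under eq_bigr => i _ do rewrite baryZ.
by rewrite -big_distrr /= mulrC ler_pdivrMr ?ltr0n // mul1r.
Qed.

Lemma ehrhart_simplex :
  ehrhart (convex_hull (range (@simplex_vertex R n m))) t
  = (\sum_(j < N) if lheight n m j <= t
       then 'C(n.+1 + (t - lheight n m j), n.+1) else 0)%N.
Proof.
rewrite /ehrhart dilate_simplexE -card_lattice_code.
set B := [set p | _]%SET.
rewrite fset_set_image; last exact: finite_finset.
rewrite (card_imfset _ _ decode_inj) /= cardE; apply/perm_size/uniq_perm.
- exact: fset_uniq.
- exact: enum_uniq.
- move=> p; rewrite in_fset_set; last exact: finite_finset.
  by rewrite mem_enum; apply/idP/idP; rewrite inE.
Qed.


End Ehrhart.

Theorem theorem6p6 (R : realType) (d : nat) (hd : (0 < d)%N) :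
  eulerian_simplex_family (S_simplex R d).
Proof.
case: d hd => // n _; split=> [m m_gt0|].
  exists (@simplex_vertex R n m); split.
  - by move=> i; exact: vertex_int.
  - exact: vertex_affinely_independent.
  - exact: S_simplexE.
have sizeT : (size ((1 - 'X) * des_poly n)%R <= n.+2)%N.
  apply: (leq_trans (size_polyMleq _ _)).
  by rewrite -opprB size_polyN size_XsubC add2n ltnS size_des_poly.
(* The part of [(1 + (m - 1) x) B] beyond [m x B]: it is free of [m], and the factor [1 - x]
   vanishes at 1. *)
exists ((1 - 'X) * des_poly n); split=> //.
  by rewrite hornerM hornerD hornerN hornerX -polyC1 hornerC subrr mul0r.
move=> m m_gt0; split.
  apply: (leq_trans (size_polyD _ _)); rewrite geq_max sizeT andbT.
  apply: (leq_trans (size_scale_leq _ _)); rewrite eulerian_polyE mulrC.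
  by apply: (leq_trans (size_polyMleq _ _)); rewrite size_polyX addn2 ltnS size_des_poly.
rewrite -sum_lheight //; apply: hstar_of_bin_series => t; rewrite S_simplexE //.
have N_gt0 : (0 < (n.+1)`! * m)%N by rewrite muln_gt0 fact_gt0.
(* At [t = 0] the series is 1 by convention, so this coefficient is checked apart from the lattice
   count. *)
rewrite /ehrhart_series; case: eqP => [->|/eqP t_neq0].
  by rewrite sum_bin_series0 // => j; exact: lheight_eq0.
rewrite (ehrhart_simplex _ _ m_gt0) ?lt0n // -natz natr_sum; apply: eq_bigr => j _.
by rewrite /bin_series; case: ifP => _; rewrite ?natz.
Qed.
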